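(* Consider the integrated single-period market clearing problem with elementary and conversion orders: $$\max_{x}\ \sum_{c\in\mathcal C}\sum_{o\in\mathcal O^c}P_o^cQ_o^cx_o^c-\sum_{c_1\neq c_2\in\mathcal C}\ \sum_{co\in\mathcal O^{c_1\to c_2}}P_{co}^{c_1\to c_2}Q_{co}^{c_1\to c_2}x_{co}^{c_1\to c_2}$$ subject to, for every carrier $c_1\in\mathcal C$, the energy balance constraint (with dual variable $\pi^{c_1}$) $$\sum_{o\in\mathcal O^{c_1}}Q_o^{c_1}x_o^{c_1}+\sum_{c_2\ne c_1}\sum_{co\in\mathcal O^{c_1\to c_2}}Q_{co}^{c_1\to c_2}x_{co}^{c_1\to c_2}-\sum_{c_2\neq c_1}\sum_{co\in\mathcal O^{c_2\to c_1}}\eta_{co}^{c_2\to c_1}Q_{co}^{c_2\to c_1}x_{co}^{c_2\to c_1}=0,$$ and $0\le x_o^c\le 1$, $0\le x_{co}^{c_1\to c_2}\le 1$ for all orders. Let $x$ be an optimal solution and let $(\pi^c)_{c\in\mathcal C}$ be market prices obtained as optimal dual variables of the energy balance constraints. Then for every conversion order $co\in\mathcal O^{c_1\to c_2}$: (1) if $\eta_{co}^{c_1\to c_2}\pi^{c_2}-\pi^{c_1}-P_{co}^{c_1\to c_2}>0$, then $x_{co}^{c_1\to c_2}=1$ (the order is fully accepted); (2) if $\eta_{co}^{c_1\to c_2}\pi^{c_2}-\pi^{c_1}-P_{co}^{c_1\to c_2}<0$, then $x_{co}^{c_1\to c_2}=0$ (the order is fully rejected); (3) if $\eta_{co}^{c_1\to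 c_2}\pi^{c_2}-\pi^{c_1}-P_{co}^{c_1\to c_2}=0$, then $x_{co}^{c_1\to c_2}\in[0,1]$ (the order can be fully accepted, partially accepted, or rejected).
   Context: $\mathcal C$ is a finite set of energy carriers (electricity, gas, heat). For each carrier $c$, $\mathcal O^c$ is a finite set of elementary orders; order $o\in\mathcal O^c$ has a limit price $P_o^c\in\mathbb R$ and a quantity $Q_o^c\in\mathbb R$, with $Q_o^c<0$ for sell orders and $Q_o^c>0$ for buy orders, and $x_o^c$ is its acceptance ratio. For $c_1\ne c_2$, $\mathcal O^{c_1\to c_2}$ is a finite set of conversion orders from carrier $c_1$ to carrier $c_2$; order $co$ has conversion price $P_{co}^{c_1\to c_2}\in\mathbb R$, total conversion capacity $Q_{co}^{c_1\to c_2}>0$, conversion efficiency $\eta_{co}^{c_1\to c_2}>0$, and acceptance ratio $x_{co}^{c_1\to c_2}$. Sign convention for dual variables: prices $(\pi^c)$ are optimal dual variables of the balance constraints if they minimise over $\mathbb R^{\mathcal C}$ the dual function $\pi\mapsto\max_x\{\text{objective}(x)-\sum_{c\in\mathcal C}\pi^c\cdot(\text{left-hand side of the balance constraint of } c)\}$, where the maximum is over $x$ satisfying all constraints other than the balance constraints (equivalently, $\pi$ is the corresponding component of an optimal solution of the linear programming dual). *)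

(* Defs.v *)
From HB Require Import structures.
From mathcomp Require Import all_boot all_order all_algebra.
From mathcomp Require Import classical_sets reals.
Set Implicit Arguments.
Unset Strict Implicit.
Unset Printing Implicit Defensive.
Import Order.TTheory GRing.Theory Num.Theory.
Local Open Scope classical_set_scope.
Local Open Scope ring_scope.

(* Conversion orders only exist between distinct carriers: the types
   [corder c c], and all data attached to them, are never used.
   An elementary order is a sell order if its quantity is negative and a buy
   order if it is positive. *)
Record market (R : realType) := Market {
  carrier : finType;
  eorder : carrier -> finType;
  eprice : forall c, eorder c -> R;
  equantity : forall c, eorder c -> R;
  equantity_neq0 : forall c (o : eorder c), equantity o != 0;
  corder : carrier -> carrier -> finType;
  cprice : forall c1 c2, corder c1 c2 -> R;
  capacity : forall c1 c2, corder c1 c2 -> R;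
  efficiency : forall c1 c2, corder c1 c2 -> R;
  capacity_gt0 : forall c1 c2 (co : corder c1 c2),
    c1 != c2 -> 0 < capacity co;
  efficiency_gt0 : forall c1 c2 (co : corder c1 c2),
    c1 != c2 -> 0 < efficiency co
}.

Record acceptance (R : realType) (M : market R) := Acceptance {
  xe : forall c : carrier M, eorder c -> R;
  xc : forall c1 c2 : carrier M, corder c1 c2 -> R
}.

Definition objective (R : realType) (M : market R) (x : acceptance M) : R :=
  \sum_(c : carrier M) \sum_(o : eorder c) eprice o * equantity o * xe x o
  - \sum_(c1 : carrier M) \sum_(c2 : carrier M | c1 != c2)
      \sum_(co : corder c1 c2) cprice co * capacity co * xc x co.

Definition balance_lhs (R : realType) (M : market R) (x : acceptance M)
    (c1 : carrier M) : R :=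
  \sum_(o : eorder c1) equantity o * xe x o
  + \sum_(c2 : carrier M | c2 != c1)
      \sum_(co : corder c1 c2) capacity co * xc x co
  - \sum_(c2 : carrier M | c2 != c1)
      \sum_(co : corder c2 c1) efficiency co * capacity co * xc x co.

Definition within_bounds (R : realType) (M : market R) (x : acceptance M) :
    Prop :=
  (forall (c : carrier M) (o : eorder c), 0 <= xe x o <= 1) /\
  (forall (c1 c2 : carrier M) (co : corder c1 c2),
     c1 != c2 -> 0 <= xc x co <= 1).

Definition feasible (R : realType) (M : market R) (x : acceptance M) : Prop :=
  within_bounds x /\ forall c : carrier M, balance_lhs x c = 0.

Definition optimal (R : realType) (M : market R) (x : acceptance M) : Prop :=
  feasible x /\
  forall y : acceptance M, feasible y -> objective y <= objective x.

Definition lagrangian (R : realType) (M : market R) (pi : carrier M -> R)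
    (x : acceptance M) : R :=
  objective x - \sum_(c : carrier M) pi c * balance_lhs x c.

(* The Lagrangian is affine in the finitely many ratios it depends on, all
   confined to [0, 1], so this supremum is always an attained maximum. *)
Definition dual_function (R : realType) (M : market R)
    (pi : carrier M -> R) : R :=
  sup [set lagrangian pi x | x in [set x : acceptance M | within_bounds x]].

Definition market_prices (R : realType) (M : market R) (pi : carrier M -> R) :
    Prop :=
  forall pi' : carrier M -> R, dual_function pi <= dual_function pi'.

(* Main.v *)
(* Strong duality, obtained from Farkas' lemma: since x is optimal, no direction
   that stays in the box and preserves the balances increases the objective, so
   the objective is a nonnegative combination of the constraints active at x.
   This gives some prices at which x maximises the Lagrangian over the box, so
   that the minimum of the dual function is at most the objective value at x.
   Hence at any minimiser pi the point x also maximises the Lagrangian, which is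
   linear in the acceptance ratio of a conversion order, with slope
   Q * (eta * pi c2 - pi c1 - P). *)
Require Import Defs.
From HB Require Import structures.
From mathcomp Require Import all_boot all_order all_algebra.
From mathcomp Require Import ring lra.
From mathcomp Require Import boolp classical_sets reals.
Import Order.TTheory GRing.Theory Num.Theory.
Local Open Scope ring_scope.

(** * Farkas' lemma *)

(* Bartl's induction: when the first inequality a 0 is indispensable, a vector v
   violating only that inequality is used to project along v onto ker (a 0). *)
Lemma farkas_ord (R : realFieldType) (J : finType) (m : nat)
    (a : 'I_m -> J -> R) (b : J -> R) :
  (forall v : J -> R, (forall i, \sum_j a i j * v j <= 0) ->
     \sum_j b j * v j <= 0) ->
  exists2 l : 'I_m -> R, forall i, 0 <= l i &
    forall j, b j = \sum_i l i * a i j.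
Proof.
elim: m => [|m IHm] in a b *.
  move=> imp; exists (fun=> 0) => // j; rewrite big_ord0.
  (* With no inequality to satisfy, [v] may be [b] itself, so the sum of the squares of [b] is at
     most 0. *)
  have := imp b (fun i => False_ind _ (notF (ltn_ord i))).
  under eq_bigr do rewrite -expr2.
  move=> sum_le0; have /eqP : \sum_k b k ^+ 2 = 0.
    by apply/eqP; rewrite eq_le sum_le0 sumr_ge0// => k _; rewrite sqr_ge0.
  rewrite psumr_eq0 => [/allP/(_ j)|k _]; last exact: sqr_ge0.
  by rewrite mem_index_enum sqrf_eq0 => /(_ isT)/eqP.
move=> imp; pose a1 i := a (lift ord0 i).
have [imp1|/existsNP[v /not_implyP[av /negP]]] := pselect
    (forall v : J -> R, (forall i, \sum_j a1 i j * v j <= 0) ->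
     \sum_j b j * v j <= 0).
  have [l l_ge0 bE] := IHm _ _ imp1.
  exists (fun i => if unlift ord0 i is Some i' then l i' else 0).
    by move=> i; case: unliftP.
  move=> j; rewrite bE big_ord_recl unlift_none mul0r add0r.
  by apply: eq_bigr => i _; rewrite liftK.
rewrite -ltNge => bv_gt0.
pose dot (f g : J -> R) := \sum_j f j * g j.
have dotB f k g w : dot f (fun j => g j - k * w j) = dot f g - k * dot f w.
  by rewrite mulr_sumr -sumrB; apply: eq_bigr => j _; ring.
have dotBl f k g w : dot (fun j => f j - k * g j) w = dot f w - k * dot g w.
  by rewrite mulr_sumr -sumrB; apply: eq_bigr => j _; ring.
have a0v_gt0 : 0 < dot (a ord0) v.
  rewrite ltNge; apply/negP => a0v; move: bv_gt0; rewrite ltNge => /negP; apply.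
  by apply: imp => i; case: (unliftP ord0 i) => [i'|] ->; [exact: av|].
set t := dot (a ord0) v in a0v_gt0.
have t_neq0 : t != 0 by rewrite gt_eqF.
(* Subtracting these multiples of [a ord0] makes every functional vanish at [v]; their values at [w]
   are then those of the original functionals at the projection [u] of [w]. *)
have [|l l_ge0 bE] := IHm (fun i j => a1 i j - dot (a1 i) v / t * a ord0 j)
                       (fun j => b j - dot b v / t * a ord0 j).
  move=> w a1w.
  pose u j := w j - dot (a ord0) w / t * v j.
  have swap k : dot (a ord0) w / t * k = k / t * dot (a ord0) w by ring.
  have : dot b u <= 0.
    apply: imp => i; case: (unliftP ord0 i) => [i'|] ->.
      have := a1w i'; rewrite -/(dot _ w) -/(dot _ u) dotBl dotB.
      by rewrite swap.
    by rewrite -/(dot _ u) dotB -/t mulfVK// subrr.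
  by rewrite -/(dot _ w) dotBl dotB swap.
(* The multiplier of [a ord0] collects the subtracted multiples. It is nonnegative because [b] is
   positive at [v] and each [a1 i] is nonpositive there. *)
exists (fun i => if unlift ord0 i is Some i' then l i'
                 else (dot b v - \sum_i l i * dot (a1 i) v) / t).
  move=> i; case: unliftP => // _; apply: divr_ge0; last exact: ltW.
  rewrite subr_ge0; apply: (@le_trans _ _ 0); last exact: ltW.
  by apply: sumr_le0 => k _; rewrite mulr_ge0_le0// ; exact: av.
move=> j; rewrite big_ord_recl unlift_none.
under [X in _ + X]eq_bigr do rewrite liftK -/(a1 _).
have /eqP := bE j; rewrite subr_eq => /eqP ->.
have -> : \sum_i l i * (a1 i j - dot (a1 i) v / t * a ord0 j) =
    \sum_i l i * a1 i j - (\sum_i l i * dot (a1 i) v) * (a ord0 j / t).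
  by rewrite mulr_suml -sumrB; apply: eq_bigr => i _; ring.
by ring.
Qed.

Lemma farkas (R : realFieldType) (I J : finType)
    (a : I -> J -> R) (b : J -> R) :
  (forall v : J -> R, (forall i, \sum_j a i j * v j <= 0) ->
     \sum_j b j * v j <= 0) ->
  exists2 l : I -> R, forall i, 0 <= l i &
    forall j, b j = \sum_i l i * a i j.
Proof.
move=> imp; have [v av|l l_ge0 bE] := @farkas_ord R J #|I| (a \o enum_val) b.
  by apply: imp => i; have := av (enum_rank i); rewrite /= enum_rankK.
exists (l \o enum_rank) => [i|j]; first exact: l_ge0.
rewrite bE (reindex_onto enum_rank enum_val) => [|i _]; last exact: enum_valK.
by apply: eq_big => [i|i _] /=; rewrite enum_rankK// eqxx.
Qed.

(** * Multipliers for linear programs over the unit box *)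

Lemma feasible_step (R : realFieldType) (J : finType) (x v : J -> R) :
  (forall j, 0 <= x j <= 1) ->
  (forall j, x j = 0 -> 0 <= v j) -> (forall j, x j = 1 -> v j <= 0) ->
  exists2 e : R, 0 < e & forall j, 0 <= x j + e * v j <= 1.
Proof.
move=> x01 v0 v1.
(* A coordinate at an end of [0, 1] may move inwards by up to 1, an interior one by its distance to
   the nearer end. The [+ 1] keeps the quotient defined when [v j] is 0. *)
pose d j := (if x j == 0 then 1 else if x j == 1 then 1
             else Num.min (x j) (1 - x j)) / (`|v j| + 1).
have dv_gt0 j : 0 < `|v j| + 1 by have := normr_ge0 (v j); lra.
exists (\big[Order.min/1]_j d j).
  apply/bigmin_gtP; split=> // j _; apply: divr_gt0 => //.
  case: eqVneq => // x_neq0; case: eqVneq => // x_neq1.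
  have /andP[] := x01 j; rewrite !le_eqVlt eq_sym (negbTE x_neq0).
  by rewrite (negbTE x_neq1) /= lt_min subr_gt0 => -> ->.
move=> j; set e := \big[_/_]_j _.
have e_ge0 : 0 <= e.
  apply: le_bigmin => // k _; apply: divr_ge0; last exact: ltW.
  have /andP[? ?] := x01 k; do 2?case: ifP => // _.
  by rewrite le_min subr_ge0; apply/andP.
have e_le : e <= d j by exact: bigmin_le.
have {e_le} : e * (`|v j| + 1) <= d j * (`|v j| + 1) by rewrite ler_wpM2r// ltW.
rewrite /d mulfVK; last by rewrite gt_eqF.
rewrite mulrDr mulr1.
have /andP[? ?] := x01 j.
have /andP[] : - (e * `|v j|) <= e * v j <= e * `|v j|.
  by rewrite -ler_norml normrM (ger0_norm e_ge0).
case: eqVneq => [/[dup] x0 /v0 ?|_].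
  by have : 0 <= e * v j by [exact: mulr_ge0]; lra.
case: eqVneq => [/[dup] x1 /v1 ?|_].
  by have : e * v j <= 0 by [exact: mulr_ge0_le0]; lra.
by case: (leP (x j)); lra.
Qed.

(** Optimality of [x] forces each reduced cost to be nonpositive where [x j] is 0, nonnegative where
    it is 1, and zero strictly in between. So [x] maximises the reduced objective term by term. *)
Lemma box_lp_multipliers (R : realFieldType) (I J : finType)
    (c : J -> R) (A : I -> J -> R) (x : J -> R) :
  (forall j, 0 <= x j <= 1) -> (forall i, \sum_j A i j * x j = 0) ->
  (forall y : J -> R, (forall j, 0 <= y j <= 1) ->
     (forall i, \sum_j A i j * y j = 0) ->
     \sum_j c j * y j <= \sum_j c j * x j) ->
  exists p : I -> R, forall y : J -> R, (forall j, 0 <= y j <= 1) ->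
    \sum_j (c j - \sum_i p i * A i j) * y j <= \sum_j c j * x j.
Proof.
move=> x01 Ax0 x_max.
(* The outward normal of the bound [b] at coordinate [k], replaced by 0 when that bound is not
   active at [x]. *)
pose act (k : J) (b : bool) : R := if x k == b%:R then - (-1) ^+ b else 0.
(* Each equality enters as two opposite inequalities; the difference of their multipliers is the
   free-signed [p]. *)
pose a (k : I * bool + J * bool) j : R := match k with
  | inl (i, b) => (-1) ^+ b * A i j
  | inr (k, b) => if k == j then act k b else 0 end.
have [v av|l l_ge0 cE] := @farkas R _ J a c.
  have Av0 i : \sum_j A i j * v j = 0.
    apply/eqP; rewrite eq_le; have := av (inl (i, false)).
    have := av (inl (i, true)); rewrite /a /=.
    under eq_bigr do rewrite expr1 mulN1r mulNr.
    under [X in _ -> X <= _ -> _]eq_bigr do rewrite expr0 mul1r.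
    by rewrite sumrN oppr_le0 => -> ->.
  have actv k b : act k b * v k <= 0.
    have := av (inr (k, b)); rewrite /a (bigD1 k)//= eqxx big1 ?addr0// => j.
    by rewrite eq_sym => /negbTE ->; rewrite mul0r.
  have [||e e_gt0 xev] := @feasible_step _ _ x v x01.
  - by move=> j xj; have := actv j false; rewrite /act xj eqxx expr0 mulN1r oppr_le0.
  - by move=> j xj; have := actv j true; rewrite /act xj eqxx expr1 opprK mul1r.
  have dotD (f : J -> R) : \sum_j f j * (x j + e * v j) =
      \sum_j f j * x j + e * \sum_j f j * v j.
    by rewrite mulr_sumr -big_split; apply: eq_bigr => j _ /=; ring.
  have := x_max _ xev; rewrite dotD gerDl pmulr_rle0//; apply => i.
  by rewrite dotD Ax0 Av0 mulr0 addr0.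
pose p i := l (inl (i, false)) - l (inl (i, true)).
pose r j := l (inr (j, false)) * act j false + l (inr (j, true)) * act j true.
have sum_bool (K : finType) (F : K * bool -> R) :
    \sum_kb F kb = \sum_k (F (k, true) + F (k, false)).
  rewrite (eq_bigr (fun kb => F (kb.1, kb.2))) => [|[]//].
  rewrite -(pair_bigA _ (fun k b => F (k, b))).
  by apply: eq_bigr => k _; rewrite big_bool.
have rE j : c j - \sum_i p i * A i j = r j.
  rewrite cE big_sumType/= !sum_bool /= (bigD1 (P := predT) j)//= eqxx.
  rewrite [X in _ + (_ + X)]big1 => [|k /negbTE ->]; last by rewrite !mulr0 addr0.
  rewrite addr0 addrAC -sumrB big1 => [|i _]; rewrite /r /p ?expr1; ring.
exists p => y y01.
(* The balances vanish at [x], so reduced and original costs agree there. *)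
have -> : \sum_j c j * x j = \sum_j (c j - \sum_i p i * A i j) * x j.
  under [RHS]eq_bigr do rewrite mulrBl mulr_suml.
  rewrite sumrB exchange_big /= [X in _ - X]big1 ?subr0// => i _.
  by under eq_bigr do rewrite -mulrA; rewrite -mulr_sumr Ax0 mulr0.
apply: ler_sum => j _; rewrite rE /r /act.
have l0 := l_ge0 (inr (j, false)); have l1 := l_ge0 (inr (j, true)).
have /andP[y0 y1] := y01 j; rewrite expr0 expr1 opprK /=.
have [->|_] := eqVneq (x j) 0.
  by rewrite eq_sym oner_eq0; nra.
by have [->|_] := eqVneq (x j) 1; nra.
Qed.

(** * The market as a linear program over the unit box *)

Section Market.
Set Implicit Arguments.
Unset Strict Implicit.
Variables (R : realType) (M : market R).

Definition order : finType :=
  ({c : carrier M & eorder c} +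
   {c1 : carrier M & {c2 : carrier M & corder c1 c2}})%type.

(* The orders in [corder c c] carry no constraint; their ratio is read as 0. *)
Definition ratio (x : acceptance M) (j : order) : R := match j with
  | inl (existT _ o) => xe x o
  | inr (existT c1 (existT c2 co)) => if c1 != c2 then xc x co else 0
  end.

Definition acceptance_of (y : order -> R) : acceptance M :=
  Acceptance (fun c o => y (inl (existT _ c o)))
             (fun c1 c2 co => y (inr (existT _ c1 (existT _ c2 co)))).

Definition obj_coef (j : order) : R := match j with
  | inl (existT _ o) => eprice o * equantity o
  | inr (existT c1 (existT c2 co)) => - (cprice co * capacity co)
  end.

(** On [corder c c] both terms can be present at once; the zero [ratio] keeps such orders out of the
    balance. *)
Definition bal_coef (c : carrier M) (j : order) : R := match j with
  | inl (existT c' o) => if c' == c then equantity o else 0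
  | inr (existT c1 (existT c2 co)) =>
      (if c1 == c then capacity co else 0)
      - (if c2 == c then efficiency co * capacity co else 0)
  end.

Lemma sum_order (F : order -> R) : \sum_j F j =
  \sum_c \sum_(o : eorder c) F (inl (existT _ c o)) +
  \sum_c1 \sum_c2 \sum_(co : corder c1 c2)
     F (inr (existT _ c1 (existT _ c2 co))).
Proof.
rewrite big_sumType /=; congr (_ + _).
  by rewrite sig_big_dep; apply: eq_bigr => -[].
under [RHS]eq_bigr do rewrite sig_big_dep.
by rewrite sig_big_dep; apply: eq_bigr => -[? []].
Qed.

Lemma objectiveE (x : acceptance M) :
  objective x = \sum_j obj_coef j * ratio x j.
Proof.
rewrite sum_order /objective; congr (_ + _).
rewrite -sumrN; apply: eq_bigr => c1 _; rewrite -sumrN big_mkcond /=.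
apply: eq_bigr => c2 _; case: ifP => _; last first.
  by rewrite big1// => co _; rewrite mulr0.
by rewrite -sumrN; apply: eq_bigr => co _; rewrite mulNr.
Qed.

Lemma balance_lhsE (x : acceptance M) (c : carrier M) :
  balance_lhs x c = \sum_j bal_coef c j * ratio x j.
Proof.
rewrite sum_order /balance_lhs -addrA; congr (_ + _).
  rewrite [RHS](bigD1 c)//= [X in _ + X]big1 ?addr0 => [|c' /negbTE ->].
    by apply: eq_bigr => o _; rewrite eqxx.
  by rewrite big1// => o _; rewrite mul0r.
under [RHS]eq_bigr do under eq_bigr do under eq_bigr do rewrite mulrBl.
under [RHS]eq_bigr do under eq_bigr do rewrite sumrB.
under [RHS]eq_bigr do rewrite sumrB.
rewrite sumrB; congr (_ - _).
  rewrite [RHS](bigD1 c)//= [X in _ + X]big1 ?addr0 => [|c' /negbTE ->].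
    rewrite eqxx big_mkcond; apply: eq_bigr => c2 _; rewrite eq_sym.
    by case: ifP => //= _; rewrite big1// => co _; rewrite mulr0.
  by rewrite big1// => c2 _; rewrite big1// => co _; rewrite mul0r.
rewrite big_mkcond; apply: eq_bigr => c1 _.
rewrite [RHS](bigD1 c)//= [X in _ + X]big1 ?addr0 => [|c' /negbTE ->].
  rewrite eqxx; case: ifP => //= _.
  by rewrite big1// => co _; rewrite mulr0.
by rewrite big1// => co _; rewrite mul0r.
Qed.

Lemma lagrangianE (pi : carrier M -> R) (x : acceptance M) :
  lagrangian pi x =
  \sum_j (obj_coef j - \sum_c pi c * bal_coef c j) * ratio x j.
Proof.
rewrite /lagrangian objectiveE.
under [X in _ - X]eq_bigr do rewrite balance_lhsE mulr_sumr.
rewrite exchange_big -sumrB; apply: eq_bigr => j _ /=.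
by rewrite mulrBl mulr_suml; congr (_ - _); apply: eq_bigr => c _; ring.
Qed.

Lemma lagrangian_coef (pi : carrier M -> R) (c1 c2 : carrier M)
    (co : corder c1 c2) (j := inr (existT _ c1 (existT _ c2 co)) : order) :
  obj_coef j - \sum_c pi c * bal_coef c j =
  capacity co * (efficiency co * pi c2 - pi c1 - cprice co).
Proof.
have sum_at (d : carrier M) (k : R) :
    \sum_c pi c * (if d == c then k else 0) = pi d * k.
  rewrite (bigD1 d)//= eqxx big1 ?addr0// => c.
  by rewrite eq_sym => /negbTE ->; rewrite mulr0.
rewrite /=; under eq_bigr do rewrite mulrBr.
by rewrite sumrB !sum_at; ring.
Qed.

Lemma ratio_bounds (x : acceptance M) :
  within_bounds x -> forall j, 0 <= ratio x j <= 1.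
Proof.
move=> [xe01 xc01] [[c o]|[c1 [c2 co]]] /=; first exact: xe01.
by case: ifP => [/xc01//|_]; rewrite lexx ler01.
Qed.

Lemma acceptance_of_bounds (y : order -> R) :
  (forall j, 0 <= y j <= 1) -> within_bounds (acceptance_of y).
Proof. by move=> y01; split=> * /=; exact: y01. Qed.

(** * Lagrangian duality for the market *)

Lemma le_dual_function (pi : carrier M -> R) (x : acceptance M) :
  within_bounds x -> lagrangian pi x <= dual_function pi.
Proof.
move=> x01; apply: ub_le_sup; last by exists x.
(* [sup] dominates its set only if the set is bounded above; as ratios lie in [0, 1], the absolute
   values of the coefficients give a bound. *)
exists (\sum_j `|obj_coef j - \sum_c pi c * bal_coef c j|).
move=> _ [y /ratio_bounds y01 <-]; rewrite lagrangianE.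
apply: ler_sum => j _; have /andP[y0 y1] := y01 j.
by rewrite (le_trans (ler_norm _))// normrM (ger0_norm y0) ler_piMr.
Qed.

(** The round trip erases the values on [corder c c]; the ratios of the all-ones vector act as the
    0-1 mask of the genuine orders. *)
Lemma ratio_acceptance_of (y : order -> R) (j : order) :
  ratio (acceptance_of y) j = ratio (acceptance_of (fun=> 1)) j * y j.
Proof.
case: j => [[c o]|[c1 [c2 co]]] /=; first by rewrite mul1r.
by case: ifP => _; rewrite ?mul1r ?mul0r.
Qed.

Lemma ratio_live (x : acceptance M) (j : order) :
  ratio (acceptance_of (fun=> 1)) j * ratio x j = ratio x j.
Proof.
case: j => [[c o]|[c1 [c2 co]]] /=; first by rewrite mul1r.
by case: ifP => _; rewrite ?mul1r ?mul0r.
Qed.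

Lemma strong_duality (x : acceptance M) : optimal x ->
  exists pi : carrier M -> R, dual_function pi <= objective x.
Proof.
move=> [[x01 bal0] x_max].
(* Equals 0 at the orders in [corder c c] and 1 elsewhere. *)
pose live := ratio (acceptance_of (fun=> 1)).
have liveE (f : order -> R) z :
    \sum_j f j * live j * ratio z j = \sum_j f j * ratio z j.
  by apply: eq_bigr => j _; rewrite -mulrA ratio_live.
have accE (f : order -> R) y :
    \sum_j f j * live j * y j = \sum_j f j * ratio (acceptance_of y) j.
  by apply: eq_bigr => j _; rewrite -mulrA -ratio_acceptance_of.
(* The box program also has variables for [corder c c]; masking the coefficients makes its objective
   and balances at [y] those of [acceptance_of y]. *)
have [||y y01 bal_y|pi pi_max] := @box_lp_multipliers R _ _
    (fun j => obj_coef j * live j) (fun c j => bal_coef c j * live j) (ratio x).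
- exact: ratio_bounds.
- by move=> c; rewrite liveE -balance_lhsE.
- rewrite liveE accE -!objectiveE; apply: x_max; split.
    exact: acceptance_of_bounds.
  by move=> c; rewrite balance_lhsE -accE.
exists pi; apply: ge_sup; first by exists (lagrangian pi x); exists x.
move=> _ [y /ratio_bounds y01 <-]; rewrite lagrangianE objectiveE.
have := pi_max _ y01; rewrite liveE; apply: le_trans.
rewrite le_eqVlt; apply/orP; left; apply/eqP; rewrite -liveE.
apply: eq_bigr => j _; rewrite mulrBl mulr_suml; congr ((_ - _) * _).
by apply: eq_bigr => c _; rewrite mulrA.
Qed.

(** The dual value at [pi] is at most that at the prices from strong duality, hence at most
    [objective x], which is the Lagrangian at [x] since its balances vanish. *)
Lemma prices_max_lagrangian (pi : carrier M -> R) (x y : acceptance M) :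
  optimal x -> market_prices pi -> within_bounds y ->
  lagrangian pi y <= lagrangian pi x.
Proof.
move=> x_opt pi_opt y01; have [pi' pi'_le] := strong_duality x_opt.
apply: (le_trans (le_dual_function pi y01)).
apply: (le_trans (pi_opt pi')); apply: (le_trans pi'_le).
rewrite /lagrangian big1 ?subr0// => c _.
by case: x_opt => [[_ ->] _]; rewrite mulr0.
Qed.

(** Changing the single ratio of [co] to [t] stays within the bounds; all other terms of the
    Lagrangian cancel, and the positive capacity can be divided out. *)
Lemma conversion_ratio_max (pi : carrier M -> R) (x : acceptance M)
    (c1 c2 : carrier M) (co : corder c1 c2) (t : R) :
  optimal x -> market_prices pi -> c1 != c2 -> 0 <= t <= 1 ->
  (efficiency co * pi c2 - pi c1 - cprice co) * t <=
  (efficiency co * pi c2 - pi c1 - cprice co) * xc x co.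
Proof.
move=> x_opt pi_opt c12 t01.
pose j0 : order := inr (existT _ c1 (existT _ c2 co)).
pose y := acceptance_of (fun j => if j == j0 then t else ratio x j).
have x01 : within_bounds x by case: x_opt => -[].
have y01 : within_bounds y.
  by apply: acceptance_of_bounds => j; case: ifP => // _; exact: ratio_bounds.
have := prices_max_lagrangian x_opt pi_opt y01.
rewrite !lagrangianE (bigD1 j0)//= [leRHS](bigD1 j0)//=.
rewrite [X in _ + X <= _](eq_bigr
  (fun j => (obj_coef j - \sum_c pi c * bal_coef c j) * ratio x j)).
  rewrite lerD2r lagrangian_coef /= c12 eqxx -!mulrA.
  by rewrite ler_pM2l ?capacity_gt0.
by move=> j /negbTE j_neq; rewrite ratio_acceptance_of j_neq ratio_live.
Qed.

End Market.

Theorem proposition1 (R : realType) (M : market R) (x : acceptance M)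
    (pi : carrier M -> R) (x_opt : optimal x) (pi_opt : market_prices pi)
    (c1 c2 : carrier M) (c1_neq_c2 : c1 != c2) (co : corder c1 c2) :
  (efficiency co * pi c2 - pi c1 - cprice co > 0 -> xc x co = 1) /\
  (efficiency co * pi c2 - pi c1 - cprice co < 0 -> xc x co = 0) /\
  (efficiency co * pi c2 - pi c1 - cprice co = 0 -> 0 <= xc x co <= 1).
Proof.
have /andP[x0 x1] : 0 <= xc x co <= 1 by case: x_opt => -[[_ xc01] _] _; exact: xc01.
have x_max t := @conversion_ratio_max R M pi x c1 c2 co t x_opt pi_opt c1_neq_c2.
split=> [slope|]; last split=> [slope|_]; last by rewrite x0.
(* Comparing with full acceptance, then with full rejection, pins the ratio to the end favoured by
   the sign of the slope. *)
- have := x_max 1; rewrite lexx ler01 ler_pM2l// => /(_ isT) ?.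
  by apply/le_anti/andP.
- have := x_max 0; rewrite lexx ler01 ler_nM2l// => /(_ isT) ?.
  by apply/le_anti/andP.
Qed.
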